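(* Let $M_\psi$ be an isometric multiplication operator on the Bloch space $\mathcal{B}$, where $\psi$ is analytic on $\mathbb{D}$. Then $\sigma(M_\psi)=\{\eta\}$, where $\eta$ is the unimodular constant value of $\psi$.
   Context: $\mathbb{D}$ is the open unit disk in $\mathbb{C}$. For $f$ analytic on $\mathbb{D}$, put $\beta_f = \sup_{z\in\mathbb{D}} (1-|z|^2)|f'(z)|$. The Bloch space $\mathcal{B}$ is the complex Banach space of analytic functions $f$ on $\mathbb{D}$ with $\beta_f<\infty$, with norm $\|f\|_{\mathcal{B}} = |f(0)|+\beta_f$. The multiplication operator with symbol $\psi$ is $M_\psi(f)=\psi f$. It is isometric on $\mathcal{B}$ if it maps $\mathcal{B}$ into $\mathcal{B}$ and $\|M_\psi f\|_{\mathcal{B}}=\|f\|_{\mathcal{B}}$ for all $f\in\mathcal{B}$ (surjectivity is not required). The paper shows that $M_\psi$ is isometric on $\mathcal{B}$ if and only if $\psi$ is a constant function of modulus $1$; this is why $\psi$ has a unimodular constant value. $\sigma(T)=\{\lambda\in\mathbb{C}: T-\lambda I \text{ is not invertible}\}$ denotes the spectrum of a bounded operator $T$ on $\mathcal{B}$. *)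

(* Defs.v *)
From Stdlib Require Import Reals Lra FunctionalExtensionality ProofIrrelevance.
From Coquelicot Require Import Coquelicot.
Open Scope R_scope.

Definition disk : Type := {z : C | Cmod z < 1}.

Lemma disk_0_proof : Cmod (RtoC 0) < 1.
Proof. rewrite Cmod_0; lra. Qed.

Definition disk_0 : disk := exist _ (RtoC 0) disk_0_proof.

(* Derivatives in the library are taken of functions on all of C.  The value
   chosen outside the open disk is irrelevant: only derivatives at points of
   the disk are ever used. *)
Definition ext (f : disk -> C) (z : C) : C :=
  match Rlt_dec (Cmod z) 1 with
  | left h => f (exist _ z h)
  | right _ => RtoC 0
  end.

(* Analytic means complex differentiable at every point of the disk. *)
Definition analytic (f : disk -> C) : Prop :=
  forall z : disk,
    @ex_derive C_AbsRing C_NormedModule (ext f) (proj1_sig z).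

(* [C_derive] is only meaningful where the function is differentiable, see
   [C_derive_correct]. *)
Definition deriv (f : disk -> C) (z : disk) : C :=
  C_derive (ext f) (proj1_sig z).

Definition beta (f : disk -> C) : Rbar :=
  Lub_Rbar (fun x : R => exists z : disk,
    x = (1 - (Cmod (proj1_sig z)) ^ 2) * Cmod (deriv f z)).

Definition in_bloch (f : disk -> C) : Prop :=
  analytic f /\ Rbar_lt (beta f) p_infty.

Record Bloch : Type := mkBloch {
  bloch_fun :> disk -> C;
  bloch_in : in_bloch bloch_fun
}.

Definition bloch_norm (f : Bloch) : R := Cmod (f disk_0) + real (beta f).

Lemma bloch_eq (f g : Bloch) : (forall z, f z = g z) -> f = g.
Proof.
destruct f as [f hf], g as [g hg]; simpl; intros H.
assert (E : f = g) by (apply functional_extensionality; exact H).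
subst g; f_equal; apply proof_irrelevance.
Qed.

Lemma ext_in (f : disk -> C) (z : disk) : ext f (proj1_sig z) = f z.
Proof.
destruct z as [z hz]; unfold ext; simpl.
destruct (Rlt_dec (Cmod z) 1) as [h|h]; [|tauto].
now rewrite (proof_irrelevance _ h hz).
Qed.

Lemma deriv_correct (f : disk -> C) (z : disk) : analytic f ->
  @is_derive C_AbsRing C_NormedModule (ext f) (proj1_sig z) (deriv f z).
Proof. intros H; apply C_derive_correct; [exact (RtoC 0) | apply H]. Qed.

Lemma deriv_unique (f : disk -> C) (z : disk) (l : C) :
  @is_derive C_AbsRing C_NormedModule (ext f) (proj1_sig z) l ->
  deriv f z = l.
Proof. apply is_C_derive_unique. Qed.

Lemma is_derive_ext_plus (f g : disk -> C) (z : disk) :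
  analytic f -> analytic g ->
  @is_derive C_AbsRing C_NormedModule (ext (fun w => (f w + g w)%C))
    (proj1_sig z) (deriv f z + deriv g z)%C.
Proof.
intros hf hg.
apply (is_derive_ext (V := C_NormedModule)
  (fun w => plus (ext f w) (ext g w : C_NormedModule))).
- intros w; unfold ext; destruct (Rlt_dec (Cmod w) 1); auto.
  apply (plus_zero_l (RtoC 0 : C_NormedModule)).
- apply (is_derive_plus (V := C_NormedModule)); now apply deriv_correct.
Qed.

Lemma is_derive_ext_scal (c : C) (f : disk -> C) (z : disk) :
  analytic f ->
  @is_derive C_AbsRing C_NormedModule (ext (fun w => (c * f w)%C))
    (proj1_sig z) (c * deriv f z)%C.
Proof.
intros hf.
apply (is_derive_ext (V := C_NormedModule)
  (fun w => scal (c : C_AbsRing) (ext f w : C_NormedModule))).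
- intros w; unfold ext; destruct (Rlt_dec (Cmod w) 1); auto.
  apply (scal_zero_r (V := C_NormedModule)).
- assert (H := filterdiff_scal_r_fct (U := AbsRing_NormedModule C_AbsRing)
    (V := C_NormedModule) c (ext f) _
    Cmult_comm (deriv_correct f z hf)).
  apply (filterdiff_ext_lin (U := AbsRing_NormedModule C_AbsRing) (V := C_NormedModule) _ _ _ H); intros y.
  change (c * (y * deriv f z) = y * (c * deriv f z))%C; ring.
Qed.

Lemma ext_cst0 : ext (fun _ => RtoC 0) = (fun _ => RtoC 0).
Proof.
apply functional_extensionality; intros z; unfold ext.
now destruct (Rlt_dec (Cmod z) 1).
Qed.

Lemma is_derive_ext_0 (z : disk) :
  @is_derive C_AbsRing C_NormedModule (ext (fun _ => RtoC 0))
    (proj1_sig z) (RtoC 0).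
Proof. rewrite ext_cst0; apply (is_derive_const (V := C_NormedModule)). Qed.

Lemma weight_pos (z : disk) : 0 < 1 - Cmod (proj1_sig z) ^ 2.
Proof.
destruct z as [z hz]; simpl; assert (h := Cmod_ge_0 z); nra.
Qed.

Lemma beta_ub (f : disk -> C) (z : disk) : Rbar_lt (beta f) p_infty ->
  (1 - Cmod (proj1_sig z) ^ 2) * Cmod (deriv f z) <= real (beta f).
Proof.
intros hf.
assert (H : Rbar_le ((1 - Cmod (proj1_sig z) ^ 2) * Cmod (deriv f z))
              (beta f)).
{ destruct (Lub_Rbar_correct (fun x : R => exists z : disk,
    x = (1 - (Cmod (proj1_sig z)) ^ 2) * Cmod (deriv f z))) as [h _].
  apply h; now exists z. }
destruct (beta f); simpl in *; tauto.
Qed.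

Lemma beta_le (f : disk -> C) (M : R) :
  (forall z : disk,
     (1 - Cmod (proj1_sig z) ^ 2) * Cmod (deriv f z) <= M) ->
  Rbar_lt (beta f) p_infty /\ real (beta f) <= M.
Proof.
intros H.
destruct (Lub_Rbar_correct (fun x : R => exists z : disk,
    x = (1 - (Cmod (proj1_sig z)) ^ 2) * Cmod (deriv f z))) as [h1 h2].
assert (hM : Rbar_le (beta f) M).
{ apply h2; intros x [z ->]; apply H. }
assert (h0 := h1 _ (ex_intro _ disk_0 eq_refl)).
fold (beta f) in h0.
destruct (beta f); simpl in *; tauto.
Qed.

Lemma beta_ge0 (f : disk -> C) : Rbar_lt (beta f) p_infty ->
  0 <= real (beta f).
Proof.
intros hf; apply Rle_trans with (2 := beta_ub f disk_0 hf).
apply Rmult_le_pos; [left; apply weight_pos | apply Cmod_ge_0].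
Qed.

Lemma beta_plus (f g : disk -> C) : in_bloch f -> in_bloch g ->
  Rbar_lt (beta (fun w => (f w + g w)%C)) p_infty /\
  real (beta (fun w => (f w + g w)%C)) <= real (beta f) + real (beta g).
Proof.
intros [af bf] [ag bg]; apply beta_le; intros z.
rewrite (deriv_unique _ _ _ (is_derive_ext_plus f g z af ag)).
assert (h1 := beta_ub f z bf); assert (h2 := beta_ub g z bg).
assert (h3 := Cmod_triangle (deriv f z) (deriv g z)).
assert (h4 := weight_pos z); nra.
Qed.

Lemma beta_scal (c : C) (f : disk -> C) : in_bloch f ->
  Rbar_lt (beta (fun w => (c * f w)%C)) p_infty /\
  real (beta (fun w => (c * f w)%C)) <= Cmod c * real (beta f).
Proof.
intros [af bf]; apply beta_le; intros z.
rewrite (deriv_unique _ _ _ (is_derive_ext_scal c f z af)), Cmod_mult.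
assert (h1 := beta_ub f z bf); assert (h2 := Cmod_ge_0 c); nra.
Qed.

Lemma in_bloch_plus (f g : disk -> C) : in_bloch f -> in_bloch g ->
  in_bloch (fun w => (f w + g w)%C).
Proof.
intros hf hg; split; [|now apply beta_plus].
intros z; eexists; apply is_derive_ext_plus; [apply hf | apply hg].
Qed.

Lemma in_bloch_scal (c : C) (f : disk -> C) : in_bloch f ->
  in_bloch (fun w => (c * f w)%C).
Proof.
intros hf; split; [|now apply beta_scal].
intros z; eexists; apply is_derive_ext_scal; apply hf.
Qed.

Lemma in_bloch_0 : in_bloch (fun _ => RtoC 0).
Proof.
split.
- intros z; eexists; apply is_derive_ext_0.
- apply (beta_le _ 0); intros z.
  rewrite (deriv_unique _ _ _ (is_derive_ext_0 z)), Cmod_0; lra.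
Qed.

Definition bloch_plus (f g : Bloch) : Bloch :=
  mkBloch (fun w => (f w + g w)%C)
    (in_bloch_plus f g (bloch_in f) (bloch_in g)).

Definition bloch_scal (c : C) (f : Bloch) : Bloch :=
  mkBloch (fun w => (c * f w)%C) (in_bloch_scal c f (bloch_in f)).

Definition bloch_zero : Bloch := mkBloch (fun _ => RtoC 0) in_bloch_0.

Definition bloch_opp (f : Bloch) : Bloch := bloch_scal (Copp (RtoC 1)) f.

Lemma bloch_norm_triangle (f g : Bloch) :
  bloch_norm (bloch_plus f g) <= bloch_norm f + bloch_norm g.
Proof.
unfold bloch_norm; simpl.
assert (h1 := Cmod_triangle (f disk_0) (g disk_0)).
assert (h2 := proj2 (beta_plus f g (bloch_in f) (bloch_in g))); lra.
Qed.

Lemma bloch_norm_scal (c : C) (f : Bloch) :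
  bloch_norm (bloch_scal c f) <= Cmod c * bloch_norm f.
Proof.
unfold bloch_norm; simpl; rewrite Cmod_mult.
assert (h2 := proj2 (beta_scal c f (bloch_in f))); lra.
Qed.

Lemma deriv_eq0_locally (f : disk -> C) (z : disk) :
  analytic f -> deriv f z = RtoC 0 -> forall eps : posreal,
  exists d : posreal, forall w : C, Cmod (w - proj1_sig z) < d ->
    Cmod (ext f w - f z) <= eps * Cmod (w - proj1_sig z).
Proof.
intros af dz eps.
destruct (deriv_correct f z af) as [_ H].
assert (P : @is_filter_lim (AbsRing_UniformSpace C_AbsRing)
  (locally (T := AbsRing_UniformSpace C_AbsRing) (proj1_sig z))
  (proj1_sig z)).
{ intros P hP; exact hP. }
destruct (H _ P eps) as [d hd].
exists d; intros w hw.
specialize (hd w hw).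
rewrite dz in hd.
change (Cmod (ext f w - ext f (proj1_sig z) - (w - proj1_sig z) * 0)
  <= eps * Cmod (w - proj1_sig z)) in hd.
rewrite ext_in in hd.
replace (ext f w - f z)%C with (ext f w - f z - (w - proj1_sig z) * 0)%C
  by ring.
exact hd.
Qed.

Lemma deriv_eq0_cst (f : disk -> C) : analytic f ->
  (forall z, deriv f z = RtoC 0) -> forall z, f z = f disk_0.
Proof.
intros af df z.
assert (hz : forall t, 0 <= t <= 1 -> Cmod (RtoC t * proj1_sig z) < 1).
{ intros t ht; rewrite Cmod_mult, Cmod_R, Rabs_right by lra.
  assert (h := proj2_sig z); assert (h' := Cmod_ge_0 (proj1_sig z)).
  simpl in *; nra. }
assert (key : forall p : C -> R,
  (forall a b, Rabs (p a - p b) <= Cmod (a - b)) ->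
  p (f disk_0) = p (f z)).
{ intros p hp.
  assert (E := eq_is_derive (V := R_NormedModule)
     (fun t : R => p (ext f (RtoC t * proj1_sig z)%C)) 0 1).
  assert (E0 : ext f (RtoC 0 * proj1_sig z)%C = f disk_0).
  { rewrite <- (ext_in f disk_0); f_equal; simpl; ring. }
  assert (E1 : ext f (RtoC 1 * proj1_sig z)%C = f z).
  { rewrite <- (ext_in f z); f_equal; ring. }
  cbv beta in E; rewrite E0, E1 in E; apply E; [|lra].
  intros t ht; apply is_derive_Reals; intros eps he.
  set (w := exist _ _ (hz t ht) : disk).
  assert (he2 : 0 < eps / 2) by lra.
  destruct (deriv_eq0_locally f w af (df w) (mkposreal _ he2)) as [d hd].
  exists d; intros s hs0 hs.
  assert (Ew : (RtoC (t + s) * proj1_sig z - proj1_sig w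
               = RtoC s * proj1_sig z)%C).
  { simpl; rewrite RtoC_plus; ring. }
  assert (hsz : Cmod (RtoC s * proj1_sig z) <= Rabs s).
  { rewrite Cmod_mult, Cmod_R; assert (h := proj2_sig z).
    assert (h' := Rabs_pos s); simpl in *; nra. }
  specialize (hd (RtoC (t + s) * proj1_sig z)%C).
  rewrite Ew in hd; specialize (hd (Rle_lt_trans _ _ _ hsz hs)).
  rewrite <- (ext_in f w) in hd; simpl in hd.
  assert (hp' := hp (ext f (RtoC (t + s) * proj1_sig z)%C)
                    (ext f (RtoC t * proj1_sig z)%C)).
  assert (hs' := Rabs_pos_lt s hs0).
  change (@zero _) with 0; rewrite Rminus_0_r.
  unfold Rdiv; rewrite Rabs_mult, Rabs_inv.
  apply Rmult_lt_reg_r with (Rabs s); [exact hs'|].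
  rewrite Rmult_assoc, Rinv_l by lra; nra. }
symmetry; apply injective_projections; apply key; intros a b.
- eapply Rle_trans; [|apply (Rmax_Cmod (a - b)%C)]; apply Rmax_l.
- eapply Rle_trans; [|apply (Rmax_Cmod (a - b)%C)]; apply Rmax_r.
Qed.

Lemma bloch_norm_eq0 (f : Bloch) : bloch_norm f = 0 -> f = bloch_zero.
Proof.
unfold bloch_norm; intros H; destruct (bloch_in f) as [af bf].
assert (h1 := beta_ge0 f bf); assert (h2 := Cmod_ge_0 (f disk_0)).
assert (h3 : f disk_0 = RtoC 0) by (apply Cmod_eq_0; lra).
apply bloch_eq; intros z; simpl; rewrite <- h3.
apply deriv_eq0_cst; [exact af|]; intros w; apply Cmod_eq_0.
assert (h4 := beta_ub f w bf); assert (h5 := weight_pos w).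
assert (h6 := Cmod_ge_0 (deriv f w)); nra.
Qed.

Definition Bloch_AbelianMonoid_mixin : AbelianMonoid.mixin_of Bloch.
Proof.
apply (AbelianMonoid.Mixin _ bloch_plus bloch_zero);
  intros; apply bloch_eq; intros; simpl; ring.
Defined.

Canonical Bloch_AbelianMonoid :=
  AbelianMonoid.Pack Bloch Bloch_AbelianMonoid_mixin Bloch.

Definition Bloch_AbelianGroup_mixin :
  AbelianGroup.mixin_of Bloch_AbelianMonoid.
Proof.
apply (AbelianGroup.Mixin Bloch_AbelianMonoid bloch_opp).
intros f; apply bloch_eq; intros z; simpl.
ring.
Defined.

Canonical Bloch_AbelianGroup := AbelianGroup.Pack Bloch
  (AbelianGroup.Class _ _ Bloch_AbelianGroup_mixin) Bloch.

Definition Bloch_ModuleSpace_mixin :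
  ModuleSpace.mixin_of C_Ring Bloch_AbelianGroup.
Proof.
apply (ModuleSpace.Mixin C_Ring Bloch_AbelianGroup bloch_scal);
  intros; apply bloch_eq; intros; unfold mult, plus, one; simpl; ring.
Defined.

Canonical Bloch_ModuleSpace := ModuleSpace.Pack C_Ring Bloch
  (ModuleSpace.Class _ _ _ Bloch_ModuleSpace_mixin) Bloch.

Definition bloch_ball (f : Bloch) (e : R) (g : Bloch) : Prop :=
  bloch_norm (minus g f) < e.

Lemma bloch_norm_opp (f : Bloch) : bloch_norm (opp f) <= bloch_norm f.
Proof.
assert (h := bloch_norm_scal (Copp (RtoC 1)) f).
rewrite Cmod_opp, Cmod_1, Rmult_1_l in h.
exact h.
Qed.

Definition Bloch_UniformSpace_mixin : UniformSpace.mixin_of Bloch.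
Proof.
apply (UniformSpace.Mixin _ bloch_zero bloch_ball); unfold bloch_ball.
- intros f e; rewrite minus_eq_zero.
  assert (h := bloch_norm_scal (RtoC 0) bloch_zero).
  rewrite Cmod_0, Rmult_0_l in h.
  replace (bloch_scal (RtoC 0) bloch_zero) with (@zero Bloch_AbelianGroup)
    in h.
  + apply Rle_lt_trans with (1 := h), cond_pos.
  + apply bloch_eq; intros z; unfold zero; simpl; ring.
- intros f g e h; apply Rle_lt_trans with (2 := h).
  rewrite <- opp_minus; apply bloch_norm_opp.
- intros f g k e1 e2 h1 h2.
  rewrite (minus_trans g).
  apply Rle_lt_trans with (1 := bloch_norm_triangle _ _); lra.
Defined.

Canonical Bloch_UniformSpace :=
  UniformSpace.Pack Bloch Bloch_UniformSpace_mixin Bloch.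

Canonical Bloch_NormedModuleAux := NormedModuleAux.Pack C_AbsRing Bloch
  (NormedModuleAux.Class C_AbsRing _ (ModuleSpace.class _ Bloch_ModuleSpace)
     Bloch_UniformSpace_mixin) Bloch.

Definition Bloch_NormedModule_mixin :
  NormedModule.mixin_of C_AbsRing Bloch_NormedModuleAux.
Proof.
apply (NormedModule.Mixin C_AbsRing Bloch_NormedModuleAux bloch_norm 1).
- exact bloch_norm_triangle.
- exact bloch_norm_scal.
- intros f g e h; exact h.
- intros f g e h; rewrite Rmult_1_l; exact h.
- exact bloch_norm_eq0.
Defined.

Canonical Bloch_NormedModule := NormedModule.Pack C_AbsRing Bloch
  (NormedModule.Class _ _ _ Bloch_NormedModule_mixin) Bloch.

(* [is_linear] includes boundedness, so the inverse is a bounded linear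
   operator. *)
Definition invertible {E : NormedModule C_AbsRing} (T : E -> E) : Prop :=
  exists S : E -> E, is_linear S /\
    (forall x, S (T x) = x) /\ (forall x, T (S x) = x).

Definition spectrum {E : NormedModule C_AbsRing} (T : E -> E) (lambda : C)
  : Prop :=
  ~ invertible (fun x => minus (T x) (scal (lambda : C_AbsRing) x)).

Definition maps_bloch (psi : disk -> C) : Prop :=
  forall f : disk -> C, in_bloch f -> in_bloch (fun z => (psi z * f z)%C).

Definition mult_op (psi : disk -> C) (hpsi : maps_bloch psi) (f : Bloch)
  : Bloch :=
  mkBloch (fun z => (psi z * f z)%C) (hpsi f (bloch_in f)).

Definition isometric {E : NormedModule C_AbsRing} (T : E -> E) : Prop :=
  forall f : E, norm (T f) = norm f.

(* Main.v *)
Require Import Defs.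
From Stdlib Require Import Reals Lra FunctionalExtensionality ProofIrrelevance.
From Coquelicot Require Import Coquelicot.
Open Scope R_scope.

(** An isometric [mult_op psi] keeps the norm of every [psi ^ n * f], and this
    for all [n] at once is enough to force [psi] to be a unimodular constant.

    Write [q n z] for [(1 - |z|^2) * |(psi ^ n)' z|].  Two choices of [f]
    are used.

    - With [f = 1], [q n z <= 1] for all [n] and [z], and the supremum of
      [q n] over the disk is exactly [1 - |psi 0| ^ n]
      ([isometric_beta_pow]).
    - With [f z = z ^ 2], whose norm is only [4 / (3 sqrt 3) < 4 / 5], the
      product rule gives
      [|q n z * |z|^2 - (1 - |z|^2) * 2 |z| |psi z|^n| <= 4 / 5].
      Letting [n] grow shows [|psi| <= 1] ([isometric_Cmod_le_1]).  Near the
      unit circle the second term is negligible, so there [q n z <= 9 / 10]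
      ([isometric_hyp_deriv_boundary]).

    Moreover [n |psi z| ^ (n - 1) * q 1 z <= 1] for all [n] gives
    [q 1 z <= 4 (1 - |psi z|)], the Schwarz-Pick inequality up to a constant
    ([isometric_hyp_deriv_gap]).  Along radii it is a differential inequality
    for [1 - |psi|^2], and Gronwall's argument shows that if [|psi 0| < 1] then
    [|psi|] stays below some [rho < 1] on [|z| <= 99 / 100]
    ([Cmod_uniform_lt_1]).  There [q n] tends uniformly to [0], hence
    [q n <= 9 / 10] on the whole disk for some large [n], whereas its supremum
    [1 - |psi 0| ^ n] is close to [1]: a contradiction.  So [|psi 0| = 1]
    ([isometric_Cmod_0]), the seminorm of [psi] is [1 - |psi 0| = 0], and [psi]
    is constant.

    The operator is then [eta] times the identity, whose spectrum is [eta] on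
    any nonzero space ([spectrum_cst_mult]). *)

(** * Derivatives on the disk *)

Lemma is_derive_ext_restrict (F : C -> C) (z : disk) (l : C) :
  @is_derive C_AbsRing C_NormedModule F (proj1_sig z) l ->
  @is_derive C_AbsRing C_NormedModule (ext (fun w => F (proj1_sig w)))
    (proj1_sig z) l.
Proof.
apply (is_derive_ext_loc (K := C_AbsRing) (V := C_NormedModule)).
destruct z as [z hz]; simpl.
assert (hd : 0 < 1 - Cmod z) by lra.
exists (mkposreal _ hd); intros w hw.
change (Cmod (w - z) < 1 - Cmod z) in hw.
unfold ext; destruct (Rlt_dec (Cmod w) 1) as [h|h]; [reflexivity|].
exfalso; apply h.
replace w with (w - z + z)%C by ring.
apply Rle_lt_trans with (1 := Cmod_triangle _ _); lra.
Qed.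

(** Both structures on the complex numbers have the modulus as norm; only
    their uniformities are written differently.  The product rule is stated for
    the ring structure, the derivative on the disk for the plane. *)
Lemma is_derive_C_ring (f : C -> C) (z l : C) :
  @is_derive C_AbsRing C_NormedModule f z l <->
  @is_derive C_AbsRing (AbsRing_NormedModule C_AbsRing) f z l.
Proof.
split; intros [_ H]; (split; [apply is_linear_scal_l | exact H]).
Qed.

Lemma is_derive_ext_mult (f g : disk -> C) (z : disk) :
  analytic f -> analytic g ->
  @is_derive C_AbsRing C_NormedModule (ext (fun w => (f w * g w)%C))
    (proj1_sig z) (deriv f z * g z + f z * deriv g z)%C.
Proof.
intros hf hg.
apply (is_derive_ext (V := C_NormedModule)
  (fun w => mult (ext f w : C_AbsRing) (ext g w : C_AbsRing))).
- intros w; unfold ext; destruct (Rlt_dec (Cmod w) 1); auto.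
  apply (mult_zero_l (K := C_AbsRing)).
- rewrite <- (ext_in f z), <- (ext_in g z).
  apply is_derive_C_ring.
  apply (is_derive_mult (K := C_AbsRing) (ext f) (ext g));
    [now apply is_derive_C_ring, deriv_correct
    |now apply is_derive_C_ring, deriv_correct | exact Cmult_comm].
Qed.

Lemma analytic_mult (f g : disk -> C) :
  analytic f -> analytic g -> analytic (fun w => (f w * g w)%C).
Proof. intros hf hg z; eexists; now apply is_derive_ext_mult. Qed.

Lemma deriv_mult (f g : disk -> C) (z : disk) :
  analytic f -> analytic g ->
  deriv (fun w => (f w * g w)%C) z = (deriv f z * g z + f z * deriv g z)%C.
Proof. intros hf hg; now apply deriv_unique, is_derive_ext_mult. Qed.

Lemma is_derive_ext_cst (c : C) (z : disk) :
  @is_derive C_AbsRing C_NormedModule (ext (fun _ => c))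
    (proj1_sig z) (RtoC 0).
Proof.
apply (is_derive_ext_restrict (fun _ => c)).
apply (is_derive_const (V := C_NormedModule)).
Qed.

Lemma analytic_cst (c : C) : analytic (fun _ => c).
Proof. intros z; eexists; apply is_derive_ext_cst. Qed.

Lemma is_derive_ext_id (z : disk) :
  @is_derive C_AbsRing C_NormedModule (ext (fun w => proj1_sig w))
    (proj1_sig z) (RtoC 1).
Proof.
apply (is_derive_ext_restrict (fun w => w)).
apply is_derive_C_ring, (is_derive_id (K := C_AbsRing)).
Qed.

Lemma analytic_id : analytic (fun w => proj1_sig w).
Proof. intros z; eexists; apply is_derive_ext_id. Qed.

Lemma analytic_pow (f : disk -> C) (n : nat) :
  analytic f -> analytic (fun w => (f w ^ n)%C).
Proof.
intros hf; induction n as [|n IH]; [exact (analytic_cst (RtoC 1))|].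
exact (analytic_mult f _ hf IH).
Qed.

Lemma deriv_pow (f : disk -> C) (n : nat) (z : disk) : analytic f ->
  deriv (fun w => (f w ^ S n)%C) z
  = (RtoC (INR (S n)) * f z ^ n * deriv f z)%C.
Proof.
intros hf.
assert (hS : forall k, deriv (fun w => (f w ^ S k)%C) z
  = (deriv f z * f z ^ k + f z * deriv (fun w => (f w ^ k)%C) z)%C).
{ intros k; apply (deriv_mult f (fun w => (f w ^ k)%C));
    [exact hf | now apply analytic_pow]. }
induction n as [|n IH]; rewrite hS.
- rewrite (deriv_unique (fun w => (f w ^ 0)%C) z _
    (is_derive_ext_cst (RtoC 1) z)); simpl; ring.
- rewrite IH, (S_INR (S n)), RtoC_plus, (Cpow_S _ n); ring.
Qed.

(** * The test functions 1 and z^2 *)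

Lemma in_bloch_one : in_bloch (fun _ => RtoC 1).
Proof.
split; [apply analytic_cst|].
apply (beta_le _ 0); intros z.
rewrite (deriv_unique _ z _ (is_derive_ext_cst (RtoC 1) z)), Cmod_0; lra.
Qed.

Definition bloch_one : Bloch := mkBloch _ in_bloch_one.

Lemma bloch_norm_one : bloch_norm bloch_one = 1.
Proof.
unfold bloch_norm; simpl; rewrite Cmod_1.
assert (h0 := beta_ge0 _ (proj2 in_bloch_one)).
enough (real (beta (fun _ => RtoC 1)) <= 0) by lra.
apply (beta_le _ 0); intros z.
rewrite (deriv_unique _ z _ (is_derive_ext_cst (RtoC 1) z)), Cmod_0; lra.
Qed.

Definition square (w : disk) : C := (proj1_sig w * proj1_sig w)%C.

Lemma analytic_square : analytic square.
Proof. apply analytic_mult; apply analytic_id. Qed.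

Lemma deriv_square (z : disk) : deriv square z = (RtoC 2 * proj1_sig z)%C.
Proof.
unfold square.
rewrite (deriv_mult (fun w => proj1_sig w) (fun w => proj1_sig w))
  by apply analytic_id.
rewrite (deriv_unique _ z _ (is_derive_ext_id z)).
replace (RtoC 2) with (RtoC 1 + RtoC 1)%C
  by (rewrite <- RtoC_plus; f_equal; lra).
ring.
Qed.

(** The maximum over [0 <= r <= 1] of [2 r (1 - r^2)] is [4 / (3 sqrt 3)]; what
    matters is that it is less than 1, the value of [r ^ 2] on the circle. *)
Lemma weight_deriv_square_le (z : disk) :
  (1 - Cmod (proj1_sig z) ^ 2) * Cmod (deriv square z) <= 4 / 5.
Proof.
rewrite deriv_square, Cmod_mult, Cmod_R, Rabs_right by lra.
destruct z as [z hz]; simpl proj1_sig; assert (h := Cmod_ge_0 z).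
set (r := Cmod z) in *.
(* With the maximiser m = 1 / sqrt 3 in place of 577/1000, the maximum minus
   the value at r factors as 2 (r - m)^2 (r + 2 m). *)
assert (h1 : 0 <= (r - 577 / 1000) ^ 2 * (r + 1154 / 1000)).
{ apply Rmult_le_pos; [apply pow2_ge_0 | lra]. }
nra.
Qed.

Lemma in_bloch_square : in_bloch square.
Proof.
split; [apply analytic_square|].
apply (beta_le _ _ weight_deriv_square_le).
Qed.

Definition bloch_square : Bloch := mkBloch square in_bloch_square.

Lemma bloch_norm_square : bloch_norm bloch_square <= 4 / 5.
Proof.
unfold bloch_norm; simpl.
replace (square disk_0) with (RtoC 0) by (unfold square; simpl; ring).
rewrite Cmod_0.
assert (h := proj2 (beta_le _ _ weight_deriv_square_le)); lra.
Qed.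

(** * Consequences of preserving the norm of psi^n f *)

Lemma iter_mult_op (psi : disk -> C) (hM : maps_bloch psi) (n : nat)
  (f : Bloch) (z : disk) :
  Nat.iter n (mult_op psi hM) f z = (psi z ^ n * f z)%C.
Proof.
induction n as [|n IH]; simpl; [ring|].
rewrite IH; ring.
Qed.

Lemma bloch_norm_iter (T : Bloch -> Bloch) (n : nat) (f : Bloch) :
  isometric (E := Bloch_NormedModule) T ->
  bloch_norm (Nat.iter n T f) = bloch_norm f.
Proof.
intros hT; induction n as [|n IH]; [reflexivity|].
rewrite <- IH; apply hT.
Qed.

(** The seminorm of [psi ^ (n + 1) * f] is at most its norm, which is that of
    [f]; the left-hand side is the product rule for its derivative. *)
Lemma isometric_weight_le (psi : disk -> C) (hpsi : analytic psi)
  (hM : maps_bloch psi) (hiso : isometric (mult_op psi hM))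
  (f : Bloch) (n : nat) (z : disk) :
  (1 - Cmod (proj1_sig z) ^ 2)
  * Cmod (RtoC (INR (S n)) * psi z ^ n * deriv psi z * f z
          + psi z ^ S n * deriv f z)
  <= bloch_norm f.
Proof.
rewrite <- (bloch_norm_iter (mult_op psi hM) (S n) f hiso).
set (g := Nat.iter (S n) (mult_op psi hM) f).
assert (E : bloch_fun g = (fun w => psi w ^ S n * f w)%C).
{ apply functional_extensionality; intros w; apply iter_mult_op. }
rewrite <- deriv_pow by exact hpsi.
rewrite <- (deriv_mult (fun w => (psi w ^ S n)%C) f z)
  by (apply analytic_pow || apply (bloch_in f); exact hpsi).
rewrite <- E; unfold bloch_norm.
assert (h1 := beta_ub g z (proj2 (bloch_in g))).
assert (h2 := Cmod_ge_0 (g disk_0)); lra.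
Qed.

Lemma isometric_hyp_deriv_le (psi : disk -> C) (hpsi : analytic psi)
  (hM : maps_bloch psi) (hiso : isometric (mult_op psi hM))
  (n : nat) (z : disk) :
  INR (S n) * Cmod (psi z) ^ n
  * ((1 - Cmod (proj1_sig z) ^ 2) * Cmod (deriv psi z)) <= 1.
Proof.
apply Rle_trans with (bloch_norm bloch_one);
  [|right; apply bloch_norm_one].
apply Rle_trans with (2 := isometric_weight_le psi hpsi hM hiso _ n z).
simpl bloch_fun.
rewrite (deriv_unique _ z _ (is_derive_ext_cst (RtoC 1) z)).
rewrite Cmult_1_r, Cmult_0_r, Cplus_0_r, !Cmod_mult, Cmod_pow, Cmod_R.
rewrite Rabs_right by apply Rle_ge, pos_INR.
right; ring.
Qed.

(** Keeping only the moduli of the two terms of the product rule for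
    [psi ^ (n + 1) * z ^ 2] avoids any discussion of their arguments: the
    difference of the moduli is at most the modulus of the sum. *)
Lemma isometric_square_gap (psi : disk -> C) (hpsi : analytic psi)
  (hM : maps_bloch psi) (hiso : isometric (mult_op psi hM))
  (n : nat) (z : disk) :
  Rabs (INR (S n) * Cmod (psi z) ^ n
        * ((1 - Cmod (proj1_sig z) ^ 2) * Cmod (deriv psi z))
        * Cmod (proj1_sig z) ^ 2
        - Cmod (psi z) ^ S n
          * ((1 - Cmod (proj1_sig z) ^ 2) * (2 * Cmod (proj1_sig z)))) <= 4 / 5.
Proof.
apply Rle_trans with (2 := bloch_norm_square).
apply Rle_trans with (2 := isometric_weight_le psi hpsi hM hiso _ n z).
simpl bloch_fun.
rewrite deriv_square.
assert (hw := weight_pos z).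
set (w := 1 - Cmod (proj1_sig z) ^ 2) in *.
unfold square.
set (A := (RtoC (INR (S n)) * psi z ^ n * deriv psi z
           * (proj1_sig z * proj1_sig z))%C).
set (B := (psi z ^ S n * (RtoC 2 * proj1_sig z))%C).
replace (_ - _) with (w * (Cmod A - Cmod B)).
- rewrite Rabs_mult, (Rabs_right w) by lra.
  apply Rmult_le_compat_l; [lra|].
  assert (hA := Cmod_triangle (A + B) (- B)).
  assert (hB := Cmod_triangle (A + B) (- A)).
  rewrite Cmod_opp in hA, hB.
  replace (A + B + - B)%C with A in hA by ring.
  replace (A + B + - A)%C with B in hB by ring.
  apply Rabs_le; lra.
- unfold A, B; rewrite !Cmod_mult, !Cmod_pow, !Cmod_R.
  rewrite (Rabs_right 2), Rabs_right by (lra || apply Rle_ge, pos_INR).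
  ring.
Qed.

(** Here the whole norm of [psi ^ n * 1] is used, including the value at the
    origin. *)
Lemma isometric_beta_pow (psi : disk -> C) (hpsi : analytic psi)
  (hM : maps_bloch psi) (hiso : isometric (mult_op psi hM)) (n : nat) :
  in_bloch (fun w => (psi w ^ n)%C) /\
  real (beta (fun w => (psi w ^ n)%C)) = 1 - Cmod (psi disk_0) ^ n.
Proof.
set (g := Nat.iter n (mult_op psi hM) bloch_one).
assert (E : (fun w => psi w ^ n)%C = bloch_fun g).
{ apply functional_extensionality; intros w; unfold g.
  rewrite iter_mult_op; symmetry; apply Cmult_1_r. }
assert (hg := bloch_norm_iter (mult_op psi hM) n bloch_one hiso).
fold g in hg; rewrite bloch_norm_one in hg; unfold bloch_norm in hg.
rewrite <- E, Cmod_pow in hg; split; [rewrite E; apply bloch_in | lra].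
Qed.

Lemma le_1_of_pow_bounded (x M : R) : (forall n, x ^ n <= M) -> x <= 1.
Proof.
intros H; destruct (Rle_or_lt x 1) as [h|h]; [exact h|exfalso].
destruct (Pow_x_infinity x) with (b := M + 1) as [n hn].
- rewrite Rabs_right; lra.
- specialize (hn n (le_n n)); specialize (H n).
  rewrite Rabs_right in hn; [lra|].
  apply Rle_ge, pow_le; lra.
Qed.

(** Off the origin the test function [z ^ 2] has nonzero derivative, so
    [isometric_square_gap] bounds the powers of [|psi z|] independently of [n],
    the other term being at most 1 by [isometric_hyp_deriv_le].  At the
    origin the norm of [psi] already bounds the value. *)
Lemma isometric_Cmod_le_1 (psi : disk -> C) (hpsi : analytic psi)
  (hM : maps_bloch psi) (hiso : isometric (mult_op psi hM)) (z : disk) :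
  Cmod (psi z) <= 1.
Proof.
destruct (Req_dec (Cmod (proj1_sig z)) 0) as [h0|h0].
- replace z with disk_0.
  2:{ apply eq_sig_hprop; [intros; apply proof_irrelevance|].
      symmetry; now apply Cmod_eq_0. }
  destruct (isometric_beta_pow psi hpsi hM hiso 1) as [[_ h1] h2].
  apply beta_ge0 in h1; rewrite pow_1 in h2; lra.
- assert (hz := Cmod_ge_0 (proj1_sig z)); assert (hz1 := proj2_sig z).
  simpl in hz1; assert (hw := weight_pos z).
  set (c := (1 - Cmod (proj1_sig z) ^ 2) * (2 * Cmod (proj1_sig z))).
  assert (hc : 0 < c) by (apply Rmult_lt_0_compat; lra).
  (* 2 exceeds 4/5 + 1; the maximum with 1 covers the power 0. *)
  apply le_1_of_pow_bounded with (M := Rmax 1 (2 / c)).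
  intros [|n]; [apply Rmax_l|].
  apply Rle_trans with (2 := Rmax_r _ _).
  apply Rmult_le_reg_r with c; [exact hc|].
  unfold Rdiv; rewrite (Rmult_assoc 2), Rinv_l, Rmult_1_r by lra.
  assert (h1 := isometric_hyp_deriv_le psi hpsi hM hiso n z).
  assert (h2 := isometric_square_gap psi hpsi hM hiso n z).
  fold c in h2; apply Rabs_le_between in h2.
  set (q := INR (S n) * Cmod (psi z) ^ n
    * ((1 - Cmod (proj1_sig z) ^ 2) * Cmod (deriv psi z))) in *.
  nra.
Qed.

(** Close to the unit circle [z ^ 2] has modulus almost 1 and hyperbolic
    derivative almost 0, but norm at most 4/5: compared with [f = 1], this
    improves the bound 1 by a fixed amount, uniformly in [n]. *)
Lemma isometric_hyp_deriv_boundary (psi : disk -> C) (hpsi : analytic psi)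
  (hM : maps_bloch psi) (hiso : isometric (mult_op psi hM))
  (n : nat) (z : disk) : 99 / 100 <= Cmod (proj1_sig z) ->
  INR (S n) * Cmod (psi z) ^ n
  * ((1 - Cmod (proj1_sig z) ^ 2) * Cmod (deriv psi z)) <= 9 / 10.
Proof.
intros hr; assert (hz1 := proj2_sig z); simpl in hz1.
assert (h2 := isometric_square_gap psi hpsi hM hiso n z).
apply Rabs_le_between, proj2 in h2.
set (q := INR (S n) * Cmod (psi z) ^ n
    * ((1 - Cmod (proj1_sig z) ^ 2) * Cmod (deriv psi z))) in *.
assert (h3 : Cmod (psi z) ^ S n <= 1).
{ rewrite <- (pow1 (S n)); apply pow_incr; split;
    [apply Cmod_ge_0 | now apply isometric_Cmod_le_1 with hM]. }
assert (h4 : 0 <= Cmod (psi z) ^ S n) by apply pow_le, Cmod_ge_0.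
set (r := Cmod (proj1_sig z)) in *.
set (p := Cmod (psi z) ^ S n) in *.
assert (hc : 0 <= (1 - r ^ 2) * (2 * r) <= 4 / 100) by (split; nra).
nra.
Qed.

(** * A Schwarz-Pick inequality up to a constant *)

(** The best [n] is about [1 / (1 - r)], for which [r ^ n] is bounded below; by
    Bernoulli's inequality the largest [n <= 1 / (2 (1 - r))] has
    [r ^ n >= 1 / 2], while [n + 1] exceeds that quotient.  For [r = 1] the
    bound for all [n] makes [d] vanish. *)
Lemma le_gap_of_pow_bound (r d : R) : 0 <= r <= 1 -> 0 <= d ->
  (forall n, INR (S n) * r ^ n * d <= 1) -> d <= 4 * (1 - r).
Proof.
intros hr hd H; destruct (Rlt_or_le r 1) as [h|h].
- assert (hx : 0 < / (2 * (1 - r))) by (apply Rinv_0_lt_compat; lra).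
  destruct (nfloor_ex (/ (2 * (1 - r))) ltac:(lra)) as [n [hn1 hn2]].
  assert (E : / (2 * (1 - r)) * (1 - r) = / 2) by (field; lra).
  assert (hb : forall k, 1 - INR k * (1 - r) <= r ^ k).
  { induction k as [|k IH]; [simpl; lra|].
    rewrite S_INR; simpl.
    assert (hk := pos_INR k).
    assert (0 <= INR k * (1 - r)) by (apply Rmult_le_pos; lra).
    nra. }
  specialize (H n); specialize (hb n); rewrite S_INR in H.
  assert (h1 : 1 / 2 <= r ^ n) by nra.
  assert (h2 : / (2 * (1 - r)) * / 2 * d <= 1).
  { apply Rle_trans with (2 := H); apply Rmult_le_compat_r; [exact hd|].
    apply Rmult_le_compat; lra. }
  replace d with (/ (2 * (1 - r)) * / 2 * d * (4 * (1 - r)))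
    by (field; lra).
  nra.
- replace r with 1 in * by lra.
  destruct (Rle_lt_or_eq_dec _ _ hd) as [h0|h0]; [|lra].
  destruct (archimed_cor1 d h0) as [[|n] [hn1 hn2]]; [now inversion hn2|].
  specialize (H n); rewrite pow1, Rmult_1_r in H.
  assert (hS : 0 < INR (S n)) by (apply lt_0_INR; exact hn2).
  exfalso; apply Rlt_not_le with (2 := H).
  rewrite <- (Rinv_r (INR (S n))) by lra.
  apply Rmult_lt_compat_l; lra.
Qed.

Lemma isometric_hyp_deriv_gap (psi : disk -> C) (hpsi : analytic psi)
  (hM : maps_bloch psi) (hiso : isometric (mult_op psi hM)) (z : disk) :
  (1 - Cmod (proj1_sig z) ^ 2) * Cmod (deriv psi z) <= 4 * (1 - Cmod (psi z)).
Proof.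
apply le_gap_of_pow_bound.
- split; [apply Cmod_ge_0 | now apply isometric_Cmod_le_1 with hM].
- apply Rmult_le_pos; [left; apply weight_pos | apply Cmod_ge_0].
- intros n; now apply isometric_hyp_deriv_le with hM.
Qed.

(** * Moving along radii *)

(** [p] stands for a real-linear functional of norm at most 1; the real and the
    imaginary part are the instances of interest. *)
Lemma is_derive_radial (p : C -> R)
  (hD : forall a b, p (a - b)%C = p a - p b)
  (hZ : forall s a, p (RtoC s * a)%C = s * p a)
  (hC : forall a, Rabs (p a) <= Cmod a)
  (f : disk -> C) (z w : disk) (t : R) :
  analytic f -> proj1_sig w = (RtoC t * proj1_sig z)%C ->
  is_derive (fun s : R => p (ext f (RtoC s * proj1_sig z)%C)) t
    (p (deriv f w * proj1_sig z)%C).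
Proof.
intros af Ew; apply is_derive_Reals; intros eps he.
destruct (deriv_correct f w af) as [_ H].
(* Half of the error, because the estimate at hand is not strict. *)
assert (he2 : 0 < eps / 2) by lra.
destruct (H (proj1_sig w) (fun P hP => hP) (mkposreal _ he2)) as [d hd].
exists d; intros s hs0 hs.
assert (Es : (RtoC (t + s) * proj1_sig z - proj1_sig w
               = RtoC s * proj1_sig z)%C).
{ rewrite Ew, RtoC_plus; ring. }
assert (hsz : Cmod (RtoC s * proj1_sig z) <= Rabs s).
{ rewrite Cmod_mult, Cmod_R; assert (h := proj2_sig z).
  assert (h' := Rabs_pos s); simpl in *; nra. }
specialize (hd (RtoC (t + s) * proj1_sig z)%C).
assert (hb : Cmod (RtoC (t + s) * proj1_sig z - proj1_sig w) < d).
{ rewrite Es; now apply Rle_lt_trans with (1 := hsz). }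
specialize (hd hb).
change (Cmod (ext f (RtoC (t + s) * proj1_sig z) - ext f (proj1_sig w)
    - (RtoC (t + s) * proj1_sig z - proj1_sig w) * deriv f w)
  <= eps / 2 * Cmod (RtoC (t + s) * proj1_sig z - proj1_sig w)) in hd.
rewrite Es in hd; rewrite <- Ew.
replace (RtoC s * proj1_sig z * deriv f w)%C
  with (RtoC s * (deriv f w * proj1_sig z))%C in hd by ring.
assert (hp := hC (ext f (RtoC (t + s) * proj1_sig z) - ext f (proj1_sig w)
    - RtoC s * (deriv f w * proj1_sig z))%C).
rewrite !hD, hZ in hp.
assert (hs' := Rabs_pos_lt s hs0).
apply Rmult_lt_reg_r with (Rabs s); [exact hs'|].
rewrite <- Rabs_mult.
replace ((_ / s - _) * s)
  with (p (ext f (RtoC (t + s) * proj1_sig z)%C) - p (ext f (proj1_sig w))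
        - s * p (deriv f w * proj1_sig z)%C) by (field; exact hs0).
nra.
Qed.

(** [v t * exp (K t)] is nondecreasing. *)
Lemma gronwall_decay (v dv : R -> R) (K : R) :
  (forall t, 0 <= t <= 1 -> is_derive v t (dv t)) ->
  (forall t, 0 <= t <= 1 -> - K * v t <= dv t) ->
  v 0 * exp (- K) <= v 1.
Proof.
intros hv hd.
assert (D : forall t, 0 <= t <= 1 ->
  is_derive (fun s => v s * exp (K * s)) t
    ((dv t + K * v t) * exp (K * t))).
{ intros t ht; assert (h := hv t ht).
  auto_derive; [now exists (dv t)|].
  replace (Derive (fun x : R => v x) t) with (dv t)
    by (symmetry; now apply is_derive_unique).
  ring. }
destruct (MVT_gen (fun s => v s * exp (K * s)) 0 1
  (fun t => (dv t + K * v t) * exp (K * t))) as [c [hc E]].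
- rewrite Rmin_left, Rmax_right by lra; intros t ht; apply D; lra.
- rewrite Rmin_left, Rmax_right by lra; intros t ht.
  apply continuity_pt_filterlim.
  apply (ex_derive_continuous (fun s => v s * exp (K * s))).
  eexists; apply D; lra.
- rewrite Rmin_left, Rmax_right in hc by lra.
  rewrite Rmult_0_r, exp_0, Rmult_1_r, Rmult_1_r in E.
  assert (h1 : 0 <= (dv c + K * v c) * exp (K * c)).
  { apply Rmult_le_pos; [assert (h := hd c hc); lra | left; apply exp_pos]. }
  apply Rmult_le_reg_r with (exp K); [apply exp_pos|].
  rewrite Rmult_assoc, <- exp_plus, Rplus_opp_l, exp_0; lra.
Qed.

Lemma is_derive_one_minus_sq (a b : R -> R) (t da db : R) :
  is_derive a t da -> is_derive b t db ->
  is_derive (fun s => 1 - (a s ^ 2 + b s ^ 2)) t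
    (- (2 * (a t * da + b t * db))).
Proof.
intros ha hb; auto_derive;
  [split; [now exists da | split; [now exists db | easy]]|].
replace (Derive (fun x => a x) t) with da
  by (symmetry; now apply is_derive_unique).
replace (Derive (fun x => b x) t) with db
  by (symmetry; now apply is_derive_unique).
ring.
Qed.

(** Cauchy-Schwarz in the plane: the sum is the real part of [a] times the
    conjugate of [b]. *)
Lemma Rabs_re_im_le (a b : C) :
  Rabs (Re a * Re b + Im a * Im b) <= Cmod a * Cmod b.
Proof.
replace (Re a * Re b + Im a * Im b) with (Re (a * Cconj b)%C)
  by (unfold Re, Im; simpl; ring).
rewrite <- (Cmod_conj b), <- Cmod_mult; apply re_le_Cmod.
Qed.

(** A quantitative maximum principle.  On [|z| <= r] the hypothesis bounds
    [|f'|] by a multiple of [1 - |f|], hence the radial derivative of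
    [1 - |f|^2] by a multiple of [1 - |f|^2] itself, which therefore decays at
    most exponentially away from the origin.  The square of the modulus is used
    because it is differentiable where [f] vanishes. *)
Lemma Cmod_uniform_lt_1 (f : disk -> C) (A r : R) :
  analytic f -> (forall z, Cmod (f z) <= 1) -> 0 <= A -> r < 1 ->
  (forall z, (1 - Cmod (proj1_sig z) ^ 2) * Cmod (deriv f z)
             <= A * (1 - Cmod (f z))) ->
  Cmod (f disk_0) < 1 ->
  exists rho, rho < 1 /\ forall z, Cmod (proj1_sig z) <= r -> Cmod (f z) <= rho.
Proof.
intros af f1 hA hr hSP f0.
set (K := 2 * (A / (1 - r ^ 2))).
set (e := (1 - Cmod (f disk_0) ^ 2) * exp (- K)).
assert (he : 0 < e).
{ apply Rmult_lt_0_compat; [|apply exp_pos].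
  assert (h := Cmod_ge_0 (f disk_0)); nra. }
exists (1 - e / 2); split; [lra|]; intros z hz.
assert (hz0 := Cmod_ge_0 (proj1_sig z)).
enough (h : e <= 1 - Cmod (f z) ^ 2).
{ assert (h' := Cmod_ge_0 (f z)); assert (h'' := f1 z).
  assert (h2 := pow2_ge_0 (1 - Cmod (f z))); nra. }
assert (ht : forall t, 0 <= t <= 1 -> Cmod (RtoC t * proj1_sig z) <= r).
{ intros t ht; rewrite Cmod_mult, Cmod_R, Rabs_right by lra; nra. }
assert (ht1 : forall t, 0 <= t <= 1 -> Cmod (RtoC t * proj1_sig z) < 1).
{ intros t h; apply Rle_lt_trans with (2 := hr); now apply ht. }
set (h := fun t : R => ext f (RtoC t * proj1_sig z)%C).
set (dh := fun t : R =>
  (C_derive (ext f) (RtoC t * proj1_sig z)%C * proj1_sig z)%C).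
assert (G := gronwall_decay (fun t => 1 - (Re (h t) ^ 2 + Im (h t) ^ 2))
  (fun t => - (2 * (Re (h t) * Re (dh t) + Im (h t) * Im (dh t)))) K).
cbv beta in G; rewrite <- !Cmod2_alt in G.
replace (h 0) with (f disk_0) in G.
2:{ unfold h; rewrite <- ext_in; f_equal; simpl; ring. }
replace (h 1) with (f z) in G.
2:{ unfold h; rewrite <- ext_in; f_equal; simpl; ring. }
apply G; clear G; intros t hT; set (w := exist _ _ (ht1 t hT) : disk).
- assert (DR : is_derive (fun s => Re (h s)) t (Re (dh t))).
  { apply (is_derive_radial Re) with (w := w);
      [intros; simpl; unfold Re; simpl; ring
      |intros; unfold Re; simpl; ring | apply re_le_Cmod | exact af
      | reflexivity]. }
  assert (DI : is_derive (fun s => Im (h s)) t (Im (dh t))).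
  { apply (is_derive_radial Im) with (w := w);
      [intros; simpl; unfold Im; simpl; ring
      |intros; unfold Im; simpl; ring
      | intros a; eapply Rle_trans; [apply Rmax_r | apply Rmax_Cmod]
      | exact af | reflexivity]. }
  exact (is_derive_one_minus_sq _ _ t _ _ DR DI).
- rewrite <- Cmod2_alt.
  assert (hCS := Rabs_re_im_le (h t) (dh t)).
  assert (E1 : h t = f w) by exact (ext_in f w).
  assert (E2 : dh t = (deriv f w * proj1_sig z)%C) by reflexivity.
  rewrite E2, Cmod_mult in hCS; rewrite E1, E2 in *.
  assert (hw : Cmod (proj1_sig w) <= r) by (apply ht; exact hT).
  assert (hw0 := Cmod_ge_0 (proj1_sig w)).
  assert (hsp := hSP w); assert (hf := f1 w).
  assert (hf0 := Cmod_ge_0 (f w)); assert (hd0 := Cmod_ge_0 (deriv f w)).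
  assert (hr2 : 0 < 1 - r ^ 2) by nra.
  assert (hd : Cmod (deriv f w) <= A / (1 - r ^ 2) * (1 - Cmod (f w))).
  { apply Rmult_le_reg_l with (1 - r ^ 2); [exact hr2|].
    replace ((1 - r ^ 2) * (A / (1 - r ^ 2) * (1 - Cmod (f w))))
      with (A * (1 - Cmod (f w))) by (field; lra).
    apply Rle_trans with (2 := hsp); apply Rmult_le_compat_r; [exact hd0|nra]. }
  assert (hB : 0 <= A / (1 - r ^ 2)) by (apply Rdiv_le_0_compat; lra).
  unfold K; set (B := A / (1 - r ^ 2)) in *.
  assert (hdz : Cmod (f w) * (Cmod (deriv f w) * Cmod (proj1_sig z))
                <= Cmod (deriv f w)).
  { assert (0 <= Cmod (deriv f w) * Cmod (proj1_sig z) <= Cmod (deriv f w))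
      by (split; nra). nra. }
  apply Rabs_le_between in hCS.
  assert (B * (1 - Cmod (f w)) <= B * (1 - Cmod (f w) ^ 2))
    by (apply Rmult_le_compat_l; nra).
  lra.
Qed.

(** Since [m rho^m] is at most the geometric sum of the first [m] powers, it
    is bounded by [1 / (1 - rho)]; the exponent [2 m] then has a factor [rho^m]
    to spare. *)
Lemma exists_pow_small (rho eps : R) : 0 <= rho < 1 -> 0 < eps ->
  exists n, INR (S n) * rho ^ n <= eps /\ rho ^ S n <= eps.
Proof.
intros hr he.
assert (h : forall m, INR m * rho ^ m * (1 - rho) <= 1 - rho ^ m).
{ induction m as [|m IH]; [simpl; lra|].
  rewrite S_INR; simpl.
  assert (h0 : 0 <= rho ^ m) by (apply pow_le; lra).
  assert (h1 : rho ^ m <= 1)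
    by (rewrite <- (pow1 m); apply pow_incr; lra).
  assert (h2 : rho * (INR m * rho ^ m * (1 - rho)) <= rho * (1 - rho ^ m))
    by (apply Rmult_le_compat_l; lra).
  assert (h3 : 0 <= (1 - rho) * (1 - rho * rho ^ m))
    by (apply Rmult_le_pos; nra).
  lra. }
destruct (pow_lt_1_zero rho) with (y := Rmin (eps * (1 - rho) / 4) (eps / 2))
  as [m hm].
- rewrite Rabs_right; lra.
- apply Rmin_glb_lt; [|lra].
  apply Rdiv_lt_0_compat; [apply Rmult_lt_0_compat; lra | lra].
- specialize (hm m (le_n m)).
  assert (h0 : 0 <= rho ^ m) by (apply pow_le; lra).
  rewrite Rabs_right in hm by lra.
  assert (hm1 := Rlt_le_trans _ _ _ hm (Rmin_l _ _)).
  assert (hm2 := Rlt_le_trans _ _ _ hm (Rmin_r _ _)).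
  exists (m + m)%nat.
  assert (hp : rho ^ (m + m) <= rho ^ m).
  { rewrite pow_add; specialize (h m).
    assert (rho ^ m <= 1) by (rewrite <- (pow1 m); apply pow_incr; lra).
    nra. }
  split.
  + rewrite S_INR, plus_INR.
    apply Rmult_le_reg_r with (1 - rho); [lra|].
    specialize (h m); rewrite pow_add in *.
    assert (h3 : INR m * rho ^ m * (1 - rho) * rho ^ m <= rho ^ m) by nra.
    assert (hm3 : rho ^ m * rho ^ m * (1 - rho) <= eps * (1 - rho) / 2)
      by nra.
    nra.
  + simpl; nra.
Qed.

(** * The symbol is a unimodular constant *)

(** If [|psi 0| < 1], some power of [psi] has seminorm at most [9 / 10] while
    its value at the origin is at most [1 / 20], so its norm is not 1.  Near the
    circle the bound comes from [z ^ 2], elsewhere from [|psi| <= rho < 1]. *)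
Lemma isometric_Cmod_0 (psi : disk -> C) (hpsi : analytic psi)
  (hM : maps_bloch psi) (hiso : isometric (mult_op psi hM)) :
  Cmod (psi disk_0) = 1.
Proof.
assert (h1 := isometric_Cmod_le_1 psi hpsi hM hiso).
destruct (Rle_lt_or_eq_dec _ _ (h1 disk_0)) as [h0|h0]; [exfalso|exact h0].
destruct (Cmod_uniform_lt_1 psi 4 (99 / 100) hpsi h1) as [rho [hr hrho]];
  [lra | lra | now apply isometric_hyp_deriv_gap with hM | exact h0 |].
assert (hrho0 : Cmod (psi disk_0) <= rho).
{ apply hrho; simpl; rewrite Cmod_0; lra. }
assert (h00 := Cmod_ge_0 (psi disk_0)).
destruct (exists_pow_small rho (1 / 20)) as [n [hn1 hn2]]; [lra | lra |].
destruct (isometric_beta_pow psi hpsi hM hiso (S n)) as [_ hbeta].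
assert (hb : real (beta (fun w => psi w ^ S n)%C) <= 9 / 10).
{ apply (beta_le _ (9 / 10)); intros z; rewrite deriv_pow by exact hpsi.
  rewrite !Cmod_mult, Cmod_pow, Cmod_R.
  rewrite Rabs_right by apply Rle_ge, pos_INR.
  destruct (Rle_or_lt (99 / 100) (Cmod (proj1_sig z))) as [hz|hz].
  - assert (h := isometric_hyp_deriv_boundary psi hpsi hM hiso n z hz); lra.
  - assert (hp : Cmod (psi z) ^ n <= rho ^ n).
    { apply pow_incr; split; [apply Cmod_ge_0 | apply hrho; lra]. }
    assert (h := isometric_hyp_deriv_le psi hpsi hM hiso 0 z).
    simpl in h; rewrite !Rmult_1_l in h.
    assert (hw := weight_pos z).
    assert (hd := Cmod_ge_0 (deriv psi z)); assert (hN := pos_INR (S n)).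
    set (q := (1 - Cmod (proj1_sig z) ^ 2) * Cmod (deriv psi z)).
    change (q <= 1) in h.
    assert (hq : 0 <= q) by (apply Rmult_le_pos; lra).
    assert (hp2 : INR (S n) * Cmod (psi z) ^ n <= 1 / 20).
    { apply Rle_trans with (2 := hn1); now apply Rmult_le_compat_l. }
    replace (_ * _) with (INR (S n) * Cmod (psi z) ^ n * q)
      by (unfold q; ring).
    nra. }
assert (hp0 : Cmod (psi disk_0) ^ S n <= rho ^ S n)
  by (apply pow_incr; lra).
lra.
Qed.

Lemma isometric_cst (psi : disk -> C) (hpsi : analytic psi)
  (hM : maps_bloch psi) (hiso : isometric (mult_op psi hM)) (z : disk) :
  psi z = psi disk_0.
Proof.
apply deriv_eq0_cst; [exact hpsi|]; intros w; apply Cmod_eq_0.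
destruct (isometric_beta_pow psi hpsi hM hiso 1) as [[_ hb] E].
rewrite pow_1, (isometric_Cmod_0 psi hpsi hM hiso) in E.
replace (fun w => psi w ^ 1)%C with psi in *
  by (apply functional_extensionality; intros; simpl; ring).
assert (h := beta_ub psi w hb); assert (hw := weight_pos w).
assert (hd := Cmod_ge_0 (deriv psi w)); nra.
Qed.

(** * The spectrum *)

(** For [lambda <> eta] division by [eta - lambda] is a bounded inverse; for
    [lambda = eta] the operator is zero, which is injective only on the zero
    space. *)
Lemma spectrum_cst_mult {E : NormedModule C_AbsRing} (T : E -> E) (eta : C) :
  (exists x : E, x <> zero) ->
  (forall x, T x = scal (eta : C_AbsRing) x) ->
  forall lambda, spectrum T lambda <-> lambda = eta.
Proof.
intros [x0 hx0] hT lambda.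
assert (hTl : forall x, minus (T x) (scal (lambda : C_AbsRing) x)
  = scal ((eta - lambda)%C : C_AbsRing) x).
{ intros x; rewrite hT; symmetry.
  exact (scal_minus_distr_r (eta : C_AbsRing) (lambda : C_AbsRing) x). }
split.
- intros hs; destruct (Ceq_dec lambda eta) as [h|h]; [exact h|].
  exfalso; apply hs.
  assert (hne : (eta - lambda)%C <> 0).
  { intros h'; apply h.
    replace lambda with (eta - (eta - lambda))%C by ring.
    rewrite h'; ring. }
  exists (fun x => scal (/ (eta - lambda) : C_AbsRing)%C x); split; [|split].
  + apply is_linear_scal_r, Cmult_comm.
  + intros x; rewrite hTl, scal_assoc.
    replace (mult _ _) with (one : C_AbsRing); [apply scal_one|].
    symmetry; now apply Cinv_l.
  + intros x; rewrite hTl, scal_assoc.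
    replace (mult _ _) with (one : C_AbsRing); [apply scal_one|].
    symmetry; now apply Cinv_r.
- intros -> [S [_ [hS _]]]; apply hx0.
  rewrite <- (hS x0), <- (hS zero).
  f_equal; rewrite !hTl.
  replace (eta - eta)%C with (@zero C_AbsRing)
    by (symmetry; apply Cplus_opp_r).
  exact (eq_trans (scal_zero_l x0) (eq_sym (scal_zero_l zero))).
Qed.

Theorem corollary4p2 (psi : disk -> C) (hpsi : analytic psi)
    (hM : maps_bloch psi) (hiso : isometric (mult_op psi hM)) :
  exists eta : C, Cmod eta = 1 /\ (forall z : disk, psi z = eta) /\
    (forall lambda : C, spectrum (mult_op psi hM) lambda <-> lambda = eta).
Proof.
exists (psi disk_0).
assert (hc := isometric_cst psi hpsi hM hiso).
split; [now apply isometric_Cmod_0 with hM | split; [exact hc|]].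
apply (spectrum_cst_mult (E := Bloch_NormedModule)).
- exists bloch_one; intros h.
  apply (f_equal (fun f : Bloch => bloch_fun f disk_0)) in h.
  injection h; lra.
- intros f; apply bloch_eq; intros z; simpl; now rewrite hc.
Qed.
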